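(* Let $a\le x<x'\le b$ be real numbers, $0<\alpha\le\frac12$, $y=(1-\alpha)x+\alpha x'$, $y'=\alpha x+(1-\alpha)x'$. Let $f:[a,b]\to\mathbb{R}$ be convex and let $p:[x,x']\to[0,\infty)$ be integrable and symmetric about $\frac{x+x'}{2}$. Let $\mathrm{Ip}_1,\mathrm{Ip}_2:[0,1]\to\mathbb{R}$ be the functions defined in the context, and let $$m=\frac{y'-y}{2(y'-x)},\qquad m'=\begin{cases}\frac12,&y\ne y',\\0,&y=y'.\end{cases}$$ Then: (1) $\mathrm{Ip}_2$ is convex on $[0,1]$. (2) $\mathrm{Ip}_2$ is decreasing on $[0,m]$ and increasing on $[m',1]$, and for all $t\in[0,1]$ $$\begin{aligned}2f\left(\frac{x+x'}{2}\right)\int_x^{x'}p(s)\,ds&\le \mathrm{Ip}_2(t)\\&\le(1-t)[f(y)+f(y')]\int_x^{x'}p(s)\,ds+t\int_x^{x'}\left[f((1-\alpha)x+\alpha s)+f((1-\alpha)x'+\alpha s)\right]p(s)\,ds\\&\le\int_x^{x'}\left[f((1-\alpha)x+\alpha s)+f((1-\alpha)x'+\alpha s)\right]p(s)\,ds\\&\le[f(x)+f(x')]\int_x^{x'}p(s)\,ds.\end{aligned}$$ (3) $\mathrm{Ip}_2(t)\le \mathrm{Ip}_1(t)$ for all $t\in[0,1]$.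
   Context: Symmetric about $\frac{x+x'}{2}$ means $p(s)=p(x+x'-s)$ for $s\in[x,x']$. Monotonicity is meant in the weak (non-strict) sense. For $t\in[0,1]$ define $$\mathrm{Ip}_1(t)=\int_x^{x'}\left[f\big(t((1-\alpha)x+\alpha s)+(1-t)y\big)+f\big(t((1-\alpha)x'+\alpha s)+(1-t)y'\big)\right]p(s)\,ds,$$ $$\mathrm{Ip}_2(t)=\int_x^{x'}\left[f\big(t((1-\alpha)x+\alpha s)+(1-t)y'\big)+f\big(t((1-\alpha)x'+\alpha s)+(1-t)y\big)\right]p(s)\,ds.$$ *)

(* Defs.v *)
From HB Require Import structures.
From mathcomp Require Import all_boot all_order all_algebra.
From mathcomp Require Import all_classical all_reals all_analysis.

Set Implicit Arguments.
Unset Strict Implicit.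
Unset Printing Implicit Defensive.

Import Order.TTheory GRing.Theory Num.Theory.
Import numFieldNormedType.Exports.

Local Open Scope classical_set_scope.
Local Open Scope ring_scope.

(* Integrals are taken with respect to the completed Lebesgue measure, whose
   measurable sets are all the Lebesgue measurable sets. The integrability
   hypothesis on p is thus the usual one; with the Borel sigma-algebra of
   lebesgue_measure, it would exclude some (even Riemann) integrable functions.
   Functions on an interval are represented by total functions, of which only
   the values on that interval matter. *)
Notation Leb R := (@completed_lebesgue_measure R).

Definition integrable_on (R : realType) (x x' : R) (p : R -> R) : Prop :=
  (Leb R).-integrable `[x, x'] (EFin \o p).

Definition integral_on (R : realType) (x x' : R) (g : R -> R) : R :=
  \int[Leb R]_(s in `[x, x']) g s.

Definition Ip1 (R : realType) (f p : R -> R) (x x' alpha y y' t : R) : R :=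
  integral_on x x' (fun s =>
    (f (t * ((1 - alpha) * x + alpha * s) + (1 - t) * y)
     + f (t * ((1 - alpha) * x' + alpha * s) + (1 - t) * y')) * p s).

Definition Ip2 (R : realType) (f p : R -> R) (x x' alpha y y' t : R) : R :=
  integral_on x x' (fun s =>
    (f (t * ((1 - alpha) * x + alpha * s) + (1 - t) * y')
     + f (t * ((1 - alpha) * x' + alpha * s) + (1 - t) * y)) * p s).

(* Main.v *)
(** With [F r = f r + f (x + x' - r)], reflecting [s] in the midpoint of
[[x, x']] in the second summand turns [Ip2 t] and [Ip1 t] into the integrals of
[F (t u(s) + (1 - t) y') p s] and [F (t u(s) + (1 - t) y) p s], where
[u(s) = (1 - alpha) x + alpha s] lies in [[x, y]]. As [F] is convex and
symmetric, it is a nondecreasing function of the distance to the midpoint, so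
the inequalities and monotonicity claims reduce to comparing, for each [s],
distances to the midpoint. As [f] may jump at [a] and [b], its measurability
comes from its sublevel sets being intervals. *)

Require Import Defs.
From HB Require Import structures.
From mathcomp Require Import all_boot all_order all_algebra.
From mathcomp Require Import all_classical all_reals all_analysis.
From mathcomp Require Import ring lra measurable_realfun.

Set Implicit Arguments.
Unset Strict Implicit.
Unset Printing Implicit Defensive.

Import Order.TTheory GRing.Theory Num.Theory.
Import numFieldNormedType.Exports.

Local Open Scope classical_set_scope.
Local Open Scope ring_scope.

(** * Invariance of the completed Lebesgue measure under reflections *)

Notation lebesgueType R :=
  (caratheodory_type (wlength (@idfun (R : realType)))^*%mu) (only parsing).
Notation lebesgue_measurable :=
  (((wlength (@idfun _))^*%mu).-cara.-measurable) (only parsing).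

Lemma completed_measurable_itv (R : realType) (i : interval R) :
  lebesgue_measurable [set` i].
Proof. by apply: sub_caratheodory; exact: measurable_itv. Qed.

Section reflection.
Context {R : realType}.
Variable c : R.
Let phi (s : R) : R := c - s.

Lemma reflect_preimage_itv ba (a : R) bb (b : R) :
  phi @^-1` [set` Interval (BSide ba a) (BSide bb b)] =
  [set` Interval (BSide (~~ bb) (c - b)) (BSide (~~ ba) (c - a))].
Proof.
apply/seteqP; split=> s /=; rewrite /phi !in_itv/= => /andP[];
case: ba; case: bb => /= h1 h2; apply/andP; split; lra.
Qed.

Lemma measurable_reflect :
  measurable_fun [set: measurableTypeR R] (phi : _ -> measurableTypeR R).
Proof. by apply: measurable_funB => //; exact: measurable_id. Qed.

(** Lebesgue measure is determined by its values on half-open intervals, and the preimage of []a,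
    b]] is [[c - b, c - a[], which has the same length. *)
Lemma lebesgue_measure_reflect (A : set R) : measurable A ->
  lebesgue_measure (phi @^-1` A) = lebesgue_measure A.
Proof.
move=> mA.
pose nu := pushforward lebesgue_measure
  (phi : measurableTypeR R -> measurableTypeR R).
have mphi := measurable_reflect.
apply/esym; apply: (@lebesgue_measure_unique R nu) => // _ [[a b]] _ <-.
rewrite /nu/= /pushforward (reflect_preimage_itv false a false b) /=.
rewrite !lebesgue_measure_itv/= !lte_fin ltrD2l ltrN2.
by case: ifP => // _; congr (_%:E); lra.
Qed.

(** The Carathéodory sigma-algebra is the completion of the Borel one. Through this decomposition
    the facts on reflections pass from Borel sets to all Lebesgue measurable sets. *)
Lemma completed_measurable_decomp (A : set R) :
  lebesgue_measurable A ->
  exists B N, [/\ measurable B, lebesgue_measure.-negligible N & A = B `|` N].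
Proof.
rewrite -completed_caratheodory_measurable g_sigma_completed_algebra_genE.
by move=> [B mB [N negN <-]]; exists B, N.
Qed.

Lemma negligible_reflect (N : set R) : lebesgue_measure.-negligible N ->
  lebesgue_measure.-negligible (phi @^-1` N).
Proof.
move=> [B [mB B0 NB]]; exists (phi @^-1` B); split.
- by rewrite -[X in measurable X]setTI; exact: measurable_reflect.
- by rewrite -B0; exact: lebesgue_measure_reflect.
- by move=> s; exact: NB.
Qed.

(** Converse to the decomposition: by completeness the negligible part is itself measurable, and it
    adds no mass. *)
Lemma completed_measurable_setU_negligible (B N : set R) : measurable B ->
  lebesgue_measure.-negligible N ->
  lebesgue_measurable (B `|` N) /\
  Leb R (B `|` N) = lebesgue_measure B.
Proof.
move=> mB [B' [mB' B'0 NB']].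
have negN : (Leb R).-negligible N.
  by exists B'; split=> //; exact: sub_caratheodory.
have mN := negligible_sub_caratheodory negN.
have mB_cara : lebesgue_measurable B by exact: sub_caratheodory.
split; first exact: measurableU.
by rewrite measureU0//; exact: measure_negligible.
Qed.

Lemma measurable_completed_reflect :
  measurable_fun setT (phi : lebesgueType R -> lebesgueType R).
Proof.
move=> _ A /completed_measurable_decomp[B [N [mB negN ->]]].
rewrite setTI preimage_setU.
apply: (completed_measurable_setU_negligible _ (negligible_reflect negN)).1.
by rewrite -[X in measurable X]setTI; exact: measurable_reflect.
Qed.

Lemma completed_lebesgue_measure_reflect (A : set R) :
  lebesgue_measurable A ->
  Leb R (phi @^-1` A) = Leb R A.
Proof.
move=> /completed_measurable_decomp[B [N [mB negN ->]]].
rewrite preimage_setU.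
rewrite (completed_measurable_setU_negligible mB negN).2.
have mphiB : measurable (phi @^-1` B : set (measurableTypeR R)).
  by rewrite -[X in measurable X]setTI; exact: measurable_reflect.
have negphiN := negligible_reflect negN.
rewrite (completed_measurable_setU_negligible mphiB negphiN).2.
exact: lebesgue_measure_reflect.
Qed.

End reflection.

(** Change of variables for the reflection in the midpoint of [[a, b]], seen as a pushforward that
    preserves the measure. *)
Lemma Rintegral_reflect (R : realType) (a b : R) (g : R -> R) :
  integrable_on a b g -> integrable_on a b (fun s => g (a + b - s)) ->
  integral_on a b (fun s => g (a + b - s)) = integral_on a b g.
Proof.
move=> ig ig'; rewrite /integral_on /Rintegral; congr fine.
set D := (`[a, b]%classic : set R).
have phiD : (fun s => a + b - s) @^-1` D = D.
  by rewrite /D reflect_preimage_itv/= addrK (addrC a) addrK.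
have mD := completed_measurable_itv `[a, b].
rewrite [LHS]integral_mkcond [RHS]integral_mkcond.
(* Since [D] is its own mirror image, extending [g] by zero outside [D] commutes with the
   reflection, so the change of variables can be made on the whole line. *)
pose h := (EFin \o g) \_ D.
pose phi (s : lebesgueType R) : lebesgueType R := a + b - s.
have mphi : measurable_fun setT phi by exact: measurable_completed_reflect.
have hE : (fun s => (g (a + b - s))%:E) \_ D = h \o phi.
  apply/funext => s; rewrite /h /= !patchE.
  by rewrite -[in LHS]phiD.
rewrite hE -[RHS](@eq_measure_integral _ _ _ _ _ (pushforward (Leb R) phi)).
  rewrite integral_pushforward//.
  - by apply/(measurable_restrictT _ mD).1; exact: measurable_int ig.
  - by rewrite -hE preimage_setT; apply/integrable_restrict; rewrite ?setTI.
by move=> A mA _; exact: completed_lebesgue_measure_reflect.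
Qed.

(** * Convex functions on a compact interval *)

Section convex.
Context {R : realType}.
Implicit Types (f g p : R -> R) (D : set R).

(** Trades the bundled coefficient of [convex_function] for a real [t] with explicit bounds, which
    suits linear arithmetic. *)
Lemma convex_functionP D f : convex_function (D : set R) f <->
  forall t r s, 0 <= t <= 1 -> D r -> D s ->
    f (t * r + (1 - t) * s) <= t * f r + (1 - t) * f s.
Proof.
split=> [fc t r s t01 Dr Ds|fc t r s /[!inE] Dr Ds].
  have it : Itv.spec (@Itv.num_sem R) (Itv.Real `[0%Z, 1%Z]) t.
    by rewrite /= /Itv.num_sem/= num_real in_itv/=.
  by apply: (fc (Itv.mk it)); rewrite inE.
by apply: fc => //; apply/andP; split.
Qed.

Lemma convex_function_subset D (E : set R) f : E `<=` D ->
  convex_function (D : set R) f -> convex_function (E : set R) f.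
Proof.
move=> ED /convex_functionP fc; apply/convex_functionP => t r s t01 Er Es.
by apply: fc => //; exact: ED.
Qed.

Lemma convex_function_comp_affine D (E : set R) f (g : R -> R) :
  (forall t r s, g (t * r + (1 - t) * s) = t * g r + (1 - t) * g s) ->
  (forall s, E s -> D (g s)) -> convex_function (D : set R) f ->
  convex_function (E : set R) (fun s => f (g s)).
Proof.
move=> gE ED /convex_functionP fc; apply/convex_functionP => t r s t01 Er Es /=.
by rewrite gE; apply: fc => //; exact: ED.
Qed.

Lemma convex_function_reflect (a b : R) f :
  convex_function (`[a, b]%classic : set R) f ->
  convex_function (`[a, b]%classic : set R) (fun s => f (a + b - s)).
Proof.
apply: convex_function_comp_affine => [t r s|s /=]; first by ring.
by rewrite !in_itv/=; lra.
Qed.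

Lemma convex_function_cst D (k : R) : convex_function (D : set R) (fun=> k).
Proof.
apply/convex_functionP => t r s _ _ _ /=.
by rewrite -mulrDl addrC subrK mul1r.
Qed.

Lemma convex_function_lin D f g (k l : R) : 0 <= k -> 0 <= l ->
  convex_function (D : set R) f -> convex_function (D : set R) g ->
  convex_function (D : set R) (fun s => k * f s + l * g s).
Proof.
move=> k0 l0 /convex_functionP fc /convex_functionP gc.
apply/convex_functionP => t r s t01 Dr Ds /=.
have := ler_wpM2l k0 (fc _ _ _ t01 Dr Ds).
have := ler_wpM2l l0 (gc _ _ _ t01 Dr Ds).
lra.
Qed.

Lemma convex_functionD D f g : convex_function (D : set R) f ->
  convex_function (D : set R) g ->
  convex_function (D : set R) (fun s => f s + g s).
Proof.
move=> /convex_functionP fc /convex_functionP gc.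
apply/convex_functionP => t r s t01 Dr Ds /=.
have := fc _ _ _ t01 Dr Ds; have := gc _ _ _ t01 Dr Ds; lra.
Qed.

Lemma itv_conv (x y r : R) : x <= r <= y ->
  exists2 t : R, 0 <= t <= 1 & r = t * x + (1 - t) * y.
Proof.
move=> /andP[xr ry]; have [xy|xy] := eqVneq x y.
  by exists 0; lra.
have yx0 : 0 < y - x by rewrite subr_gt0 lt_neqAle xy (le_trans xr).
exists ((y - r) / (y - x)); last by field; rewrite gt_eqF.
by rewrite divr_ge0 ?ler_pdivrMr// ?mul1r; lra.
Qed.

(** Maximum principle: a value inside is at most a convex combination of the two end values. *)
Lemma convex_function_le (a b M : R) f :
  convex_function (`[a, b]%classic : set R) f ->
  f a <= M -> f b <= M -> forall r, r \in `[a, b] -> f r <= M.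
Proof.
move=> /convex_functionP fc faM fbM r; rewrite in_itv => /= rab.
have [t t01 ->] := itv_conv rab.
apply: le_trans (fc _ _ _ t01 _ _) _; rewrite /= ?in_itv/=; try lra.
by move/andP: t01 => [t0 t1]; nra.
Qed.

(** The end values bound [f] by [M] from above. Convexity at the midpoint of [r] and its mirror
    image then bounds it from below: [f r] is at least [2 * f ((a + b) / 2) - M]. *)
Lemma convex_function_bounded (a b : R) f :
  convex_function (`[a, b]%classic : set R) f ->
  [bounded f s | s in `[a, b]%classic].
Proof.
move=> fc; pose M := Num.max (f a) (f b).
have fM r : r \in `[a, b] -> f r <= M.
  by apply: (convex_function_le fc); rewrite /M le_max lexx ?orbT.
exists (`|M| + 2 * `|f ((a + b) / 2)|); split; first exact: num_real.
move=> N MN r /= rab; apply: ltW; apply: le_lt_trans MN.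
have rab' : a + b - r \in `[a, b] by move: rab; rewrite !in_itv/=; lra.
have /convex_functionP /(_ 2^-1 r (a + b - r)) := fc.
rewrite (_ : 2^-1 * r + _ = (a + b) / 2); last by field.
move=> /(_ _ rab rab') fmid.
have {}fmid : 2 * f ((a + b) / 2) <= f r + f (a + b - r).
  have h : 0 <= (2^-1 : R) <= 1. rewrite invr_ge0 invf_le1 ?ler1n ?ler0n//.
  move: fmid => /(_ h) h2. lra.
have := fM _ rab; have := fM _ rab'.
have := ler_norm M; have := ler_norm (- f ((a + b) / 2)); rewrite normrN.
have := normr_ge0 (f ((a + b) / 2)).
move=> h1 h2 h3 h4 h5.
suff : `|f r : R| <= `|M| + 2 * `|f ((a + b) / 2)| by [].
by rewrite ler_norml; apply/andP; split; lra.
Qed.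

Lemma convex_function_measurable (a b : R) f :
  convex_function (`[a, b]%classic : set R) f ->
  measurable_fun (`[a, b]%classic : set R) f.
Proof.
move=> fc mD.
apply: (measurability (@RGenInftyO.G R)) => //= [|_ [_] [r] -> <-] //.
  exact: RGenInftyO.measurableE.
apply: is_interval_measurable => s t/=.
rewrite !in_itv/= => -[/andP[as_ sb] fs] [/andP[at_ tb] ft] u /andP[su ut].
split; first by rewrite in_itv/=; apply/andP; split; lra.
(* For [u] between two points [s], [t] of a strict sublevel set, the maximum principle on [[s, t]]
   keeps [f u] below the level. *)
have fcst : convex_function (`[s, t]%classic : set R) f.
  by apply: convex_function_subset fc => v /=; rewrite !in_itv/=; lra.
apply: (@le_lt_trans _ _ (Num.max (f s) (f t))); last by rewrite gt_max fs.
apply: (convex_function_le fcst); rewrite ?le_max ?lexx ?orbT//.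
by rewrite in_itv/=; lra.
Qed.

(** The disjunction says that [r1] is no farther from the midpoint than [r2], for [r2] on either
    side. Then [r1] lies between [r2] and its mirror image, where [f] takes equal values, and the
    maximum principle applies. *)
Lemma convex_function_sym_le (a b r1 r2 : R) f :
  convex_function (`[a, b]%classic : set R) f ->
  (forall r, f (a + b - r) = f r) -> r2 \in `[a, b] ->
  r2 <= r1 <= a + b - r2 \/ a + b - r2 <= r1 <= r2 -> f r1 <= f r2.
Proof.
move=> fc fs r2ab [r12|r12].
  have fc2 : convex_function (`[r2, a + b - r2]%classic : set R) f.
    apply: convex_function_subset fc => v /=.
    by move: r2ab; rewrite !in_itv/=; lra.
  by apply: (convex_function_le fc2); rewrite ?fs// in_itv.
have fc2 : convex_function (`[a + b - r2, r2]%classic : set R) f.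
  apply: convex_function_subset fc => v /=.
    by move: r2ab; rewrite !in_itv/=; lra.
by apply: (convex_function_le fc2); rewrite ?fs// in_itv.
Qed.

End convex.

(** * Integrals of convex functions against the weight [p] *)

Section weighted_integral.
Context {R : realType}.
Implicit Types (h p : R -> R).

Lemma integrable_on_eq (x x' : R) p q : {in `[x, x'], p =1 q} ->
  integrable_on x x' p -> integrable_on x x' q.
Proof.
move=> pq; apply: eq_integrable.
  exact: completed_measurable_itv.
by move=> s /[!inE] /= sx; rewrite pq.
Qed.

(** The convex factor is bounded and Borel measurable, hence also measurable for the completed
    measure, so multiplying by it preserves integrability. *)
Lemma integrable_on_convexM (x x' : R) h p :
  convex_function (`[x, x']%classic : set R) h -> integrable_on x x' p ->
  integrable_on x x' (fun s => h s * p s).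
Proof.
move=> hc ip.
have mD := completed_measurable_itv `[x, x'].
apply: (integrableMr mD _ (convex_function_bounded hc) ip) => _ Y mY.
apply: sub_caratheodory.
by apply: (convex_function_measurable hc) => //; exact: measurable_itv.
Qed.

Lemma le_integral_on (x x' : R) h1 h2 p :
  convex_function (`[x, x']%classic : set R) h1 ->
  convex_function (`[x, x']%classic : set R) h2 ->
  integrable_on x x' p -> {in `[x, x'], forall s, 0 <= p s} ->
  {in `[x, x'], forall s, h1 s <= h2 s} ->
  integral_on x x' (fun s => h1 s * p s) <=
  integral_on x x' (fun s => h2 s * p s).
Proof.
move=> h1c h2c ip p0 h12; apply: le_Rintegral.
- exact: completed_measurable_itv.
- exact: integrable_on_convexM.
- exact: integrable_on_convexM.
- by move=> s sx; rewrite ler_wpM2r ?p0 ?h12.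
Qed.

Lemma integral_on_lin (x x' : R) h1 h2 p (k l : R) :
  convex_function (`[x, x']%classic : set R) h1 ->
  convex_function (`[x, x']%classic : set R) h2 ->
  integrable_on x x' p ->
  integral_on x x' (fun s => (k * h1 s + l * h2 s) * p s) =
  k * integral_on x x' (fun s => h1 s * p s) +
  l * integral_on x x' (fun s => h2 s * p s).
Proof.
move=> h1c h2c ip.
have mD := completed_measurable_itv `[x, x'].
have ih1 := integrable_on_convexM h1c ip.
have ih2 := integrable_on_convexM h2c ip.
rewrite /integral_on -!RintegralZl// -RintegralD//; last 2 first.
- exact: (integrableZl mD k ih1).
- exact: (integrableZl mD l ih2).
by apply: eq_Rintegral => s _; ring.
Qed.

(** Only the [h2] part is reflected; the symmetry of [p] leaves the weight unchanged. *)
Lemma integral_on_symmetrize (x x' : R) h1 h2 p :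
  convex_function (`[x, x']%classic : set R) h1 ->
  convex_function (`[x, x']%classic : set R) h2 ->
  integrable_on x x' p -> {in `[x, x'], forall s, p s = p (x + x' - s)} ->
  integral_on x x' (fun s => (h1 s + h2 s) * p s) =
  integral_on x x' (fun s => (h1 s + h2 (x + x' - s)) * p s).
Proof.
move=> h1c h2c ip psym.
have h2c' := convex_function_reflect h2c.
(* The coefficients [1] bring both sides into the form of [integral_on_lin], which splits the
   sums. *)
have -> : integral_on x x' (fun s => (h1 s + h2 s) * p s) =
    integral_on x x' (fun s => (1 * h1 s + 1 * h2 s) * p s).
  by apply: eq_Rintegral => s _; rewrite !mul1r.
have -> : integral_on x x' (fun s => (h1 s + h2 (x + x' - s)) * p s) =
    integral_on x x' (fun s => (1 * h1 s + 1 * h2 (x + x' - s)) * p s).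
  by apply: eq_Rintegral => s _; rewrite !mul1r.
rewrite !integral_on_lin//; congr (_ + 1 * _).
have ih2 := integrable_on_convexM h2c' ip.
have h2E : {in `[x, x'], (fun s => h2 (x + x' - s) * p s) =1
    (fun s => h2 (x + x' - s) * p (x + x' - s))}.
  by move=> s sx /=; rewrite psym.
rewrite -(Rintegral_reflect (integrable_on_convexM h2c ip)).
  by apply: eq_Rintegral => s /[!inE] sx; rewrite h2E.
exact: integrable_on_eq h2E _.
Qed.

End weighted_integral.

(** * The arguments of [f] in [Ip1] and [Ip2], and the symmetrised form of both integrals *)

Section inscribed.
Context {R : realType}.
Variables (x x' alpha : R).
Hypotheses (xx' : x < x') (alpha01 : 0 <= alpha <= 1).

(** The argument of [f] in the first summand: [z] is [y] for [Ip1] and [y'] for [Ip2]. *)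
Let A (t z s : R) := t * ((1 - alpha) * x + alpha * s) + (1 - t) * z.

Lemma inscribed_point_bounds s : s \in `[x, x'] ->
  x <= (1 - alpha) * x + alpha * s <= (1 - alpha) * x + alpha * x'.
Proof.
rewrite in_itv/= => /andP[xs sx']; have /andP[a0 _] := alpha01.
have := ler_wpM2l a0 xs; have := ler_wpM2l a0 sx'.
by move=> h1 h2; apply/andP; split; lra.
Qed.

Lemma inscribed_conv_in t z s : 0 <= t <= 1 -> z \in `[x, x'] ->
  s \in `[x, x'] -> A t z s \in `[x, x'].
Proof.
move=> t01 zx sx; have := inscribed_point_bounds sx; move: zx sx t01.
rewrite /A !in_itv/=; set u := _ + alpha * s => zx sx t01 /andP[xu uy].
have ux : u <= x'.
  by apply: le_trans uy _; have /andP[_ a1] := alpha01; nra.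
case/andP: t01 => t0 t1; case/andP: zx => xz zx'.
have t1' : 0 <= 1 - t by lra.
have := ler_wpM2l t0 xu; have := ler_wpM2l t0 ux.
have := ler_wpM2l t1' xz; have := ler_wpM2l t1' zx'.
by move=> h1 h2 h3 h4; apply/andP; split; lra.
Qed.

Lemma convex_function_inscribed f t z : 0 <= t <= 1 -> z \in `[x, x'] ->
  convex_function (`[x, x']%classic : set R) f ->
  convex_function (`[x, x']%classic : set R) (fun s => f (A t z s)).
Proof.
move=> t01 zx; apply: convex_function_comp_affine => [u r s|s /= sx].
  by rewrite /A; ring.
exact: inscribed_conv_in.
Qed.

(** The argument of [f] in the second summand at [s] is the mirror image of [A t z (x + x' - s)], so
    reflecting [s] in that summand alone expresses both through the same point [A t z s]. *)
Lemma integral_on_inscribed_sym f p t z z' : 0 <= t <= 1 -> z \in `[x, x'] ->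
  z' = x + x' - z ->
  convex_function (`[x, x']%classic : set R) f ->
  integrable_on x x' p -> {in `[x, x'], forall s, p s = p (x + x' - s)} ->
  integral_on x x' (fun s =>
    (f (t * ((1 - alpha) * x + alpha * s) + (1 - t) * z)
     + f (t * ((1 - alpha) * x' + alpha * s) + (1 - t) * z')) * p s) =
  integral_on x x' (fun s => (f (A t z s) + f (x + x' - A t z s)) * p s).
Proof.
move=> t01 zx -> fc ip psym.
pose g s := t * ((1 - alpha) * x' + alpha * s) + (1 - t) * (x + x' - z).
have gE s : g s = x + x' - A t z (x + x' - s) by rewrite /g /A; ring.
rewrite (@integral_on_symmetrize _ _ _ (f \o A t z) (f \o g))//=.
- apply: eq_Rintegral => s _.
  by rewrite gE; congr ((_ + f _) * _); rewrite /A; ring.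
- exact: convex_function_inscribed.
- apply: convex_function_comp_affine fc => [u r s|s /= sx].
    by rewrite /g; ring.
  have : x + x' - s \in `[x, x'] by move: sx; rewrite !in_itv/=; lra.
  rewrite gE.
  by move/(inscribed_conv_in t01 zx); rewrite !in_itv/=; lra.
Qed.

End inscribed.

(** * Convexity, monotonicity and bounds by pointwise comparison of the symmetrised integrands *)

Theorem theorem9 (R : realType) (a b x x' alpha y y' m m' : R) (f p : R -> R)
    (hax : a <= x) (hxx' : x < x') (hx'b : x' <= b)
    (halpha0 : 0 < alpha) (halpha1 : alpha <= 2^-1)
    (hy : y = (1 - alpha) * x + alpha * x')
    (hy' : y' = alpha * x + (1 - alpha) * x')
    (hf : convex_function (`[a, b]%classic : set R) f)
    (hp0 : {in `[x, x'], forall s, 0 <= p s})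
    (hpint : integrable_on x x' p)
    (hpsym : {in `[x, x'], forall s, p s = p (x + x' - s)})
    (hm : m = (y' - y) / (2 * (y' - x)))
    (hm' : m' = if y != y' then 2^-1 else 0) :
  let I1 := Ip1 f p x x' alpha y y' in
  let I2 := Ip2 f p x x' alpha y y' in
  let P := integral_on x x' p in
  let J := integral_on x x' (fun s =>
    (f ((1 - alpha) * x + alpha * s) + f ((1 - alpha) * x' + alpha * s))
    * p s) in
  [/\ (* (1) *)
      convex_function (`[0, 1]%classic : set R) I2,
      (* (2) *)
      [/\ {in `[0, m] &, nonincreasing_fun I2},
          {in `[m', 1] &, nondecreasing_fun I2} &
          {in `[0, 1], forall t,
            [/\ 2 * f ((x + x') / 2) * P <= I2 t,
                I2 t <= (1 - t) * (f y + f y') * P + t * J,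
                (1 - t) * (f y + f y') * P + t * J <= J &
                J <= (f x + f x') * P]}] &
      (* (3) *)
      {in `[0, 1], forall t, I2 t <= I1 t}].
Proof.
move=> I1 I2 P J.
have a01 : 0 <= alpha <= 1 by apply/andP; split; lra.
have d0 : 0 < x' - x by lra.
(* These two bounds on the product [alpha * (x' - x)] let linear arithmetic place [y] between [x]
   and the midpoint, and [y'] symmetrically. *)
have ad0 : 0 <= alpha * (x' - x) by rewrite mulr_ge0 ?ltW.
have ad1 : alpha * (x' - x) <= 2^-1 * (x' - x) by rewrite ler_pM2r.
have xy : x <= y by lra.
have yy' : y <= y' by lra.
have yE : y = x + x' - y' by lra.
have y'E : y' = x + x' - y by lra.
have yx : y \in `[x, x'] by rewrite in_itv/=; apply/andP; split; lra.
have y'x : y' \in `[x, x'] by rewrite in_itv/=; apply/andP; split; lra.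
have {}hf : convex_function (`[x, x']%classic : set R) f.
  by apply: convex_function_subset hf => s /=; rewrite !in_itv/=; lra.
pose F (r : R) : R := f r + f (x + x' - r).
have Fc : convex_function (`[x, x']%classic : set R) F.
  exact: convex_functionD hf (convex_function_reflect hf).
have Fsym r : F (x + x' - r) = F r by rewrite /F subKr addrC.
have Fle r1 r2 := @convex_function_sym_le _ x x' r1 r2 F Fc Fsym.
pose u (s : R) : R := (1 - alpha) * x + alpha * s.
pose A (z t s : R) : R := t * u s + (1 - t) * z.
have ux s : s \in `[x, x'] -> x <= u s <= y.
  by move/(inscribed_point_bounds a01); rewrite -hy.
have Ax z t s : z \in `[x, x'] -> t \in `[0, 1] -> s \in `[x, x'] ->
    A z t s \in `[x, x'].
  by rewrite [t \in _]in_itv => zx t01 sx; exact: inscribed_conv_in.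
have FAc z t : z \in `[x, x'] -> t \in `[0, 1] ->
    convex_function (`[x, x']%classic : set R) (fun s => F (A z t s)).
  by rewrite [t \in _]in_itv => zx t01; exact: convex_function_inscribed.
have I2E t : t \in `[0, 1] ->
    I2 t = integral_on x x' (fun s => F (A y' t s) * p s).
  by rewrite in_itv => t01; exact: integral_on_inscribed_sym.
have I1E t : t \in `[0, 1] ->
    I1 t = integral_on x x' (fun s => F (A y t s) * p s).
  by rewrite in_itv => t01; exact: integral_on_inscribed_sym.
have in01 : (1 : R) \in `[0, 1] by rewrite in_itv/= ler01 lexx.
have A1 s : A y' 1 s = u s by rewrite /A subrr mul0r addr0 mul1r.
(* [J] is the value of [I2] at [1], so it inherits the symmetrised form. *)
have JE : J = integral_on x x' (fun s => F (u s) * p s).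
  transitivity (I2 1).
    by apply: eq_Rintegral => s _; rewrite !subrr !mul0r !addr0 !mul1r.
  by rewrite I2E//; apply: eq_Rintegral => s _; rewrite A1.
have Fuc : convex_function (`[x, x']%classic : set R) (fun s => F (u s)).
  have := FAc _ _ y'x in01.
  by congr convex_function; apply/funext => s; rewrite A1.
(* Multiples of [P] become integrals of constants against [p]; constants being convex,
   [le_integral_on] covers these bounds too. *)
have cstP k : integral_on x x' (fun s => k * p s) = k * P.
  by apply: RintegralZl => //; exact: completed_measurable_itv.
have cstc k := @convex_function_cst R `[x, x']%classic k.
split.
(* For fixed [s] the point [A y' t s] is affine in [t], so the integrand is convex in [t];
   integrating keeps this. *)
- apply/convex_functionP => t r s t01 r01 s01.
  have [t0 t1] := andP t01.
  have t1' : 0 <= 1 - t by lra.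
  have rs01 : t * r + (1 - t) * s \in `[0, 1].
    move: r01 s01; rewrite /= !in_itv/= => /andP[r0 r1] /andP[s0 s1].
    have := mulr_ge0 t0 r0; have := mulr_ge0 t1' s0.
    have := ler_wpM2l t0 r1; have := ler_wpM2l t1' s1.
    by move=> h1 h2 h3 h4; apply/andP; split; lra.
  rewrite !I2E// -integral_on_lin//; [|exact: FAc|exact: FAc].
  apply: le_integral_on => //; first exact: FAc.
    by apply: convex_function_lin => //; exact: FAc.
  move=> v vx; rewrite (_ : A _ _ _ = t * A y' r v + (1 - t) * A y' s v).
    by have /convex_functionP := Fc; apply => //=; exact: Ax.
  by rewrite /A; ring.
- split.
  (* [m] is the parameter at which [t * x + (1 - t) * y'] reaches the midpoint. As [x <= u s <= y'],
     for [t] up to [m] the point [A y' t s] stays right of the midpoint and moves left, towards it,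
     as [t] grows. *)
  + move=> t1 t2 t1m t2m t12.
    have yx0 : 0 < 2 * (y' - x) by lra.
    have mt t : t \in `[0, m] -> t \in `[0, 1] /\ t * (2 * (y' - x)) <= y' - y.
      rewrite !in_itv/= hm ler_pdivlMr// => /andP[t0 tm]; split => //.
      by rewrite t0/= -(ler_pM2r yx0); lra.
    have [t1i t1y] := mt _ t1m.
    have [t2i t2y] := mt _ t2m.
    rewrite !I2E//; apply: le_integral_on => //; [exact: FAc|exact: FAc|].
    move=> s sx; apply: Fle; first exact: Ax.
    have /andP[xu uy] := ux _ sx; right.
    move: t1i t2i; rewrite !in_itv/= => /andP[t10 _] /andP[t20 _].
    have := ler_wpM2l t10 xu; have := ler_wpM2l t20 xu.
    have t120 : 0 <= t2 - t1 by lra.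
    have uy' : u s <= y' by lra.
    have := ler_wpM2l t120 uy'.
    by rewrite /A => h1 h2 h3; apply/andP; split; lra.
  (* From [t = 1/2] on, [t * y + (1 - t) * y'] is left of the midpoint. If [y = y'], both are the
     midpoint and every [t >= 0] will do. Past [m'] the point [A y' t s] therefore moves away from
     the midpoint. *)
  + have half t : t \in `[m', 1] -> t \in `[0, 1] /\ forall r, r <= y ->
        t * r + (1 - t) * y' <= (x + x') / 2.
      rewrite !in_itv/= hm' => /andP[mt t1].
      have t0 : 0 <= t by apply: le_trans mt; case: ifP => _ //; lra.
      split => [|r ry]; first by rewrite t0.
      have := ler_wpM2l t0 ry.
      case: eqVneq mt => [<- /= _|_ /= mt]; first by lra.
      have t2 : 0 <= t - 2^-1 by lra.
      have yy0 : 0 <= y' - y by lra.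
      by have := mulr_ge0 t2 yy0; lra.
    move=> t1 t2 /half[t1i t1h] /half[t2i t2h] t12.
    rewrite !I2E//; apply: le_integral_on => //; [exact: FAc|exact: FAc|].
    move=> s sx; apply: Fle; first exact: Ax.
    have /andP[xu uy] := ux _ sx; left.
    have := t1h _ uy; have := t2h _ uy.
    have t120 : 0 <= t2 - t1 by lra.
    have uy' : u s <= y' by lra.
    have := ler_wpM2l t120 uy'.
    by rewrite /A => h1 h2 h3; apply/andP; split; lra.
  + move=> t t01; have /[!in_itv]/= /andP[t0 t1] := t01.
    have t1' : 0 <= 1 - t by lra.
    have Fy : f y + f y' = F y' by rewrite /F -yE addrC.
    (* As [u s <= y] and [y] mirrors [y'], the point [y'] is no farther from the midpoint than
       [u s]. The third inequality follows by mixing this bound with [J]. *)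
    have FyJ : F y' * P <= J.
      rewrite -cstP JE; apply: le_integral_on => // s sx.
      have /andP[xu uy] := ux _ sx.
      apply: Fle; last by left; apply/andP; split; lra.
      by rewrite in_itv/=; apply/andP; split; lra.
    split.
    * rewrite I2E// -cstP; apply: le_integral_on => //; first exact: FAc.
      (* The midpoint is its own mirror image, so [F] there is [2 * f ((x + x') / 2)], the least
         value of [F]. *)
      move=> s sx; rewrite (_ : 2 * _ = F ((x + x') / 2)); last first.
        rewrite /F (_ : x + x' - _ = (x + x') / 2); last by field.
        by rewrite mulr_natl mulr2n.
      apply: Fle; first exact: Ax.
      by have [h|h] := leP (A y' t s) ((x + x') / 2); [left|right];
        apply/andP; split; lra.
    * rewrite I2E// JE Fy -mulrA -cstP -integral_on_lin//.
      apply: le_integral_on => //; first exact: FAc.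
        exact: convex_function_lin.
      (* Convexity of [F] on the segment from [u s] to [y']. *)
      move=> s sx; rewrite [leRHS]addrC.
      have /convex_functionP := Fc; apply => //=.
      by have /andP[xu uy] := ux _ sx; rewrite in_itv/=; apply/andP; split; lra.
    * by rewrite Fy -mulrA; have := ler_wpM2l t1' FyJ; lra.
    (* The endpoint [x] is as far from the midpoint as any point of the interval, so [F x] dominates
       [F (u s)]. *)
    * rewrite (_ : f x + f x' = F x); last by rewrite /F [x + _]addrC addrK.
      rewrite JE -cstP; apply: le_integral_on => // s sx.
      have /andP[xu uy] := ux _ sx.
      apply: Fle; first by rewrite in_itv/= lexx ltW.
      by left; apply/andP; split; lra.
- move=> t t01; have /[!in_itv]/= /andP[t0 t1] := t01.
  have t1' : 0 <= 1 - t by lra.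
  rewrite I1E// I2E//; apply: le_integral_on => //; [exact: FAc|exact: FAc|].
  move=> s sx; have /andP[xu uy] := ux _ sx.
  apply: Fle; first exact: Ax.
  (* [A y t s <= A y' t s], and their sum [2 * t * u s + (1 - t) * (y + y')] is at most
     [y + y' = x + x'] because [u s <= y <= y']; so the point of [I2] is the one nearer to the
     midpoint. *)
  left; have := ler_wpM2l t0 uy; have := ler_wpM2l t0 yy'.
  have := ler_wpM2l t1' yy'.
  by rewrite /A => h1 h2 h3; apply/andP; split; lra.
Qed.
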